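(* Let $R\subseteq\mathbb{R}$ be a bounded interval. Let $L$ be a lattice that is rank supersolvable with respect to an $R$-grading $\rho:L\to R$, and let $A$ be an antichain cutset for $L$. Then there is some grading $\sigma$ of $L$ under which $A$ is a level set.
   Context: For a subset $R$ of the extended reals $[-\infty,\infty]$, an $R$-grading (or $R$-rank function) of a poset $L$ is a function $L\to R$ whose restriction to every maximal chain of $L$ is an order isomorphism onto $R$. A grading of $L$ is an $R'$-grading for some $R'\subseteq[-\infty,\infty]$. A level set of a grading $\sigma$ is a set of the form $\{x\in L:\sigma(x)=r\}$ for some value $r$. Given a lattice $L$ with an $R$-grading $\rho$, an element $m\in L$ is rank modular (with respect to $\rho$) if $\rho(x\vee m)+\rho(x\wedge m)=\rho(x)+\rho(m)$ for every $x\in L$. The lattice $L$ is rank supersolvable with respect to $\rho$ if it has a maximal chain consisting of rank modular elements (such a chain is called a chief chain). An antichain cutset in $L$ is an antichain $A\subseteq L$ such that every maximal chain of $L$ has nonempty intersection with $A$. *)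

(* Defs.v *)
From HB Require Import structures.
From mathcomp Require Import all_boot all_order all_algebra.
From mathcomp Require Import all_classical all_reals all_analysis.

Set Implicit Arguments.
Unset Strict Implicit.
Unset Printing Implicit Defensive.

Import Order.TTheory GRing.Theory Num.Theory.

Local Open Scope classical_set_scope.
Local Open Scope order_scope.

Definition chain d (L : porderType d) (C : set L) : Prop :=
  total_on C (fun x y => x <= y).

Definition maximal_chain d (L : porderType d) (C : set L) : Prop :=
  chain C /\ forall D : set L, chain D -> C `<=` D -> D = C.

(* The codomain T is the real line for rank functions whose values get added
   (rank modularity), and the extended real line for gradings in general. *)
Definition R_grading d d' (L : porderType d) (T : porderType d')
    (R : set T) (f : L -> T) : Prop :=
  set_fun [set: L] R f /\
  forall C : set L, maximal_chain C ->
    set_bij C R f /\ {in C &, {mono f : x y / x <= y}}.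

Definition grading (K : realType) d (L : porderType d) (f : L -> \bar K) :
    Prop :=
  exists R : set (\bar K), R_grading R f.

(* The value r is required to be attained, so a level set is never empty. *)
Definition level_set d (L : porderType d) (T : Type) (f : L -> T)
    (A : set L) : Prop :=
  exists2 r, range f r & A = [set x | f x = r].

Definition rank_modular (K : realType) d (L : latticeType d) (rho : L -> K)
    (m : L) : Prop :=
  forall x : L, (rho (x `|` m)%O + rho (x `&` m)%O = rho x + rho m)%R.

Definition rank_supersolvable (K : realType) d (L : latticeType d)
    (rho : L -> K) : Prop :=
  exists2 M : set L, maximal_chain M & forall m, M m -> rank_modular rho m.

Definition antichain d (L : porderType d) (A : set L) : Prop :=
  forall x y, A x -> A y -> x <= y -> x = y.

Definition antichain_cutset d (L : porderType d) (A : set L) : Prop :=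
  antichain A /\ forall C : set L, maximal_chain C -> C `&` A !=set0.

(* Main.v *)
Require Import Defs.
From HB Require Import structures.
From mathcomp Require Import all_boot all_order all_algebra.
From mathcomp Require Import all_classical all_reals all_analysis.
From mathcomp Require Import lra.

(** Every element of the lattice is comparable to an element of [A], since
    singletons extend to maximal chains.  So [L] is the union of the part above
    [A] and the part below it, meeting exactly in [A], and it is enough to
    grade each part strictly monotonically with value [0] on [A].  The part
    below is the part above for the dual lattice ranked by [- rho]
    ([upper_half_rank], and the section on duality).

    Let [M] be the chief chain and [b] the supremum of [R].  For [x] above [A],
    the chain made of [x] and of the meets of [x] with the members of [M] takes
    every rank of [R] up to [rho x] ([lower_section_rank]): along [M] the rank
    of the meet is 1-Lipschitz by modularity, and boundedness of [R] makes it
    approach [rho x].  Hence this chain is the lower part of a maximal chain and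
    contains exactly one element of [A], the foot of [x].  The new rank of [x]
    is the relative position of [rho x] between [rho (foot x)] and [b]:

      height x = (rho x - rho (foot x)) / (b - rho (foot x)).

    With g = rho x - rho (foot x) this is g / (g + (b - rho x)).  Modularity
    makes g weakly increasing in [x] ([foot_gap_mono]) while b - rho x is
    strictly decreasing, so the height is strictly increasing ([height_lt]).

    The main point is that every maximal chain [C] attains the value
    v = height x of any [x] strictly above [A] ([height_surj]).  For each u in
    [R], go up to the element c of [C] of rank u + v (b - u), and down again to
    the element e of rank u in the lower section of c.  By modularity these e
    form a chain; it takes all ranks in [R], so it is a maximal chain and meets
    [A].  If e is in [A], it is the foot of c, and the choice of the rank of c
    says that height c = v. *)

Set Implicit Arguments.
Unset Strict Implicit.
Unset Printing Implicit Defensive.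

Import Order.TTheory GRing.Theory Num.Theory.

Local Open Scope classical_set_scope.
Local Open Scope ring_scope.

(** * A one-sided intermediate value theorem *)

(** An upper bound on the increments is enough: it forbids upward jumps, and
    these are the only way to go from below [v] to above [v] without taking the
    value [v]. *)
Lemma lipschitz_ivt (K : realType) (f : K -> K) (a b v : K) :
  a <= b ->
  (forall s t, a <= s -> s <= t -> t <= b -> f t - f s <= t - s) ->
  f a <= v <= f b -> exists2 c, a <= c <= b & f c = v.
Proof.
move=> ab flip /andP[fav vfb].
pose S := [set s | a <= s <= b /\ f s <= v].
have Sa : S a by split; rewrite ?lexx.
have Sub : ubound S b by move=> s [/andP[]].
pose c := sup S.
have ac : a <= c by apply: ub_le_sup => //; exists b.
have cb : c <= b by apply: ge_sup => //; exists a.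
exists c; first by rewrite ac cb.
have [fcv|vfc|//] := ltgtP (f c) v.
- have ltcb : c < b.
    by rewrite lt_neqAle cb andbT; apply/eqP => e; move: fcv; rewrite e; lra.
  (* f stays below v on the next v - f c units, which contradicts the choice
     of c as a supremum *)
  pose s := Num.min b (c + (v - f c)).
  have cs : c < s by rewrite /s lt_min ltcb /=; lra.
  have sb : s <= b by rewrite /s ge_min lexx.
  have sc : s <= c + (v - f c) by rewrite /s ge_min lexx orbT.
  have Ss : S s.
    split; first by rewrite sb andbT; lra.
    by have := flip c s ac (ltW cs) sb; lra.
  have : s <= c by apply: ub_le_sup => //; exists b.
  lra.
- (* a point where f is at most v lies at least f c - v before c *)
  have : c <= c - (f c - v).
    apply: ge_sup; first by exists a.
    move=> s Ss; have [/andP[las _] fsv] := Ss.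
    have sc : s <= c by apply: ub_le_sup => //; exists b.
    by have := flip s c las sc cb; lra.
  lra.
Qed.

(** * Chains and rank functions *)

(** Zorn's lemma is applied to the sets that form a chain together with [E],
    rather than to the chains containing [E], so that the empty union
    satisfies the property. *)
Lemma chain_extend d (L : porderType d) (E : set L) :
  chain E -> exists2 C, maximal_chain C & E `<=` C.
Proof.
move=> chE.
have [D [chD Dmax]] : exists D, chain (E `|` D) /\
    forall B, D `<` B -> ~ chain (E `|` B).
  apply: Zorn_bigcup => F Fch Ftot x y.
  move=> [Ex|[X FX Xx]] [Ey|[Y FY Yy]].
  - exact: chE.
  - by apply: (Fch _ FY); [left|right].
  - by apply: (Fch _ FX); [right|left].
  - by have [XY|YX] := Ftot _ _ FX FY;
      [apply: (Fch _ FY)|apply: (Fch _ FX)]; right=> //; [exact: XY|exact: YX].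
exists (E `|` D); last by move=> x; left.
split=> // B chB EDB; apply/seteqP; split=> // x Bx.
right; apply: contrapT => nDx.
apply: (Dmax B); last first.
  by rewrite (setUidr (subset_trans (@subsetUl _ E D) EDB)).
split; last by move=> /(_ x Bx).
by move=> y Dy; apply: EDB; right.
Qed.

Lemma chain_pair d (L : porderType d) (x y : L) :
  (x <= y)%O -> chain [set x; y].
Proof.
move=> xy a b [->|->] [->|->]; rewrite ?lexx; by [left|right|left|right].
Qed.

Section RankedPoset.
Context (K : realType) (R : set K) (d : Order.disp_t) (L : porderType d).
Context (rho : L -> K) (hrho : R_grading R rho).
Implicit Types (x y : L) (C E : set L).

Lemma rank_le x y : (x <= y)%O -> rho x <= rho y.
Proof.
move=> xy; have [C Cmax EC] := chain_extend (chain_pair xy).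
by rewrite (hrho.2 _ Cmax).2 // in_setE; apply: EC; [left|right].
Qed.

Lemma rank_le_anti x y : (x <= y)%O -> rho y <= rho x -> x = y.
Proof.
move=> xy ryx; have [C Cmax EC] := chain_extend (chain_pair xy).
have yx : (y <= x)%O.
  by rewrite -(hrho.2 _ Cmax).2 // in_setE; apply: EC; [right|left].
by apply/eqP; rewrite eq_le xy.
Qed.

Lemma rank_lt x y : (x < y)%O -> rho x < rho y.
Proof.
move=> xy; rewrite ltNge; apply/negP => /(rank_le_anti (ltW xy)) e.
by rewrite e ltxx in xy.
Qed.

Lemma rank_range x : R (rho x).
Proof. exact: hrho.1. Qed.

Lemma maximal_chain_rank C r : maximal_chain C -> R r ->
  exists2 c, C c & rho c = r.
Proof. by move=> /hrho.2[[_ _ sur] _] /sur[c]; exists c. Qed.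

Lemma chain_rank_le C x y :
  chain C -> C x -> C y -> rho x <= rho y -> (x <= y)%O.
Proof.
move=> chC Cx Cy r; have [//|yx] := chC _ _ Cx Cy.
by rewrite (rank_le_anti yx r).
Qed.

Lemma chain_rank_inj C x y :
  chain C -> C x -> C y -> rho x = rho y -> x = y.
Proof.
move=> chC Cx Cy e.
have xy : (x <= y)%O by apply: (chain_rank_le chC) => //; rewrite e.
by apply: rank_le_anti => //; rewrite e.
Qed.
End RankedPoset.

(** Any larger chain has the same ranks, and the rank is injective on chains.
    This is how maximal chains, hence elements of a cutset, are produced. *)
Lemma rank_maximal_chain (K : realType) (R : set K) d (L : porderType d)
    (rho : L -> K) (E : set L) :
  R_grading R rho -> chain E ->
  (forall r, R r -> exists2 e, E e & rho e = r) -> maximal_chain E.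
Proof.
move=> hrho chE Esur; split=> // D chD ED; apply/seteqP; split=> // x Dx.
have [e Ee re] := Esur _ (rank_range hrho x).
by rewrite -(chain_rank_inj hrho chD (ED _ Ee) Dx re).
Qed.

(** * Modular elements *)

Section RankModular.
Context (K : realType) (R : set K) (d : Order.disp_t) (L : latticeType d).
Context (rho : L -> K) (hrho : R_grading R rho).
Implicit Types x y m : L.

(** By modularity, [rho x - rho (x `&` m)] equals [rho (x `|` m) - rho m],
    which is visibly monotone in [x]. *)
Lemma rank_modular_meet x y m : rank_modular rho m -> (x <= y)%O ->
  rho x - rho (x `&` m)%O <= rho y - rho (y `&` m)%O.
Proof.
move=> mm xy; have := mm x; have := mm y.
have : rho (x `|` m)%O <= rho (y `|` m)%O.
  by apply: (rank_le hrho); rewrite leU2.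
lra.
Qed.

(** Adding the modular identities of the two elements of the chain turns the
    increment of the meets into [rho m' - rho m] minus the increment of the
    joins, which is nonnegative. *)
Lemma rank_modular_meet_lipschitz x m m' :
  rank_modular rho m -> rank_modular rho m' -> (m <= m')%O ->
  rho (x `&` m')%O - rho (x `&` m)%O <= rho m' - rho m.
Proof.
move=> mm mm' lemm; have := mm x; have := mm' x.
have : rho (x `|` m)%O <= rho (x `|` m')%O.
  by apply: (rank_le hrho); rewrite leU2.
lra.
Qed.
End RankModular.

(** * The new rank above the cutset *)

Definition upper_set d (L : porderType d) (A : set L) : set L :=
  [set x | exists2 a, A a & (a <= x)%O].

(** [x] is listed separately because [M] may have no top element, in which case
    [x] need not be the meet of [x] with a member of [M]. *)
Definition lower_section d (L : latticeType d) (M : set L) (x : L) : set L :=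
  [set e | e = x \/ exists2 m, M m & e = (x `&` m)%O].

Section UpperHalf.
Context (K : realType) (R : set K).
Context (hRint : is_interval R) (hRub : has_ubound R).
Context (d : Order.disp_t) (L : latticeType d) (rho : L -> K).
Context (hrho : R_grading R rho) (M : set L) (hM : maximal_chain M).
Context (modM : forall m, M m -> rank_modular rho m).
Context (A : set L) (hA : antichain_cutset A).
Implicit Types (x y m a e : L) (C : set L).

Lemma rank_le_sup x : rho x <= sup R.
Proof. by apply: ub_le_sup => //; exact: (rank_range hrho). Qed.

(** Let [m s] be the member of [M] of rank [s].  The rank of [x `&` m s] is at
    most [u] at [s = u].  It is [rho x + s - rho (x `|` m s)], which is at least
    [rho x + s - sup R], hence at least [u] at [s = t], the value chosen in the
    proof; this [t] is below [sup R] because [u] is strictly below [rho x]. *)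
Lemma lower_section_rank x u : R u -> u <= rho x ->
  exists2 e, lower_section M x e & rho e = u.
Proof.
move=> Ru; rewrite le_eqVlt => /predU1P[->|ux]; first by exists x => //; left.
have xb := rank_le_sup x.
pose t := u + (sup R - rho x).
have ut : u <= t by rewrite /t; lra.
have Rt : R t.
  have /sup_gt[|w Rw tw] : t < sup R by rewrite /t; lra.
    by exists u.
  by apply: (hRint Ru Rw); rewrite ut ltW.
have /choice[m hm] : forall s, exists m, R s -> M m /\ rho m = s.
  move=> s; case: (pselect (R s)) => [Rs|nRs]; last by exists x.
  by have [m Mm rm] := maximal_chain_rank hrho hM Rs; exists m.
have Rs s : u <= s -> s <= t -> R s.
  by move=> us st; apply: (hRint Ru Rt); rewrite us st.
have [||s /andP[us st] rs] :=
  @lipschitz_ivt K (fun s => rho (x `&` m s)%O) u t u ut.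
- move=> s s' us ss' s't.
  have [Mm rm] := hm s (Rs _ us (le_trans ss' s't)).
  have [Mm' rm'] := hm s' (Rs _ (le_trans us ss') s't).
  rewrite -{2}rm -{2}rm'; apply: (rank_modular_meet_lipschitz hrho);
    [exact: modM|exact: modM|].
  by apply: (chain_rank_le hrho hM.1); rewrite ?rm ?rm'.
- have [Mu ru] := hm u Ru; have [Mt rt] := hm t Rt.
  apply/andP; split.
    by rewrite -[leRHS]ru; apply: (rank_le hrho); exact: leIr.
  have := modM Mt x; have := rank_le_sup (x `|` m t)%O; rewrite rt /t; lra.
have [Ms _] := hm s (Rs _ us st).
by exists (x `&` m s)%O => //; right; exists (m s).
Qed.

Lemma lower_section_le x e : lower_section M x e -> (e <= x)%O.
Proof. by move=> [->//|[m _ ->]]; exact: leIl. Qed.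

Lemma lower_section_chain x : chain (lower_section M x).
Proof.
move=> e e' se [->|[m' Mm' ->]]; first by left; exact: lower_section_le.
case: se => [->|[m Mm ->]]; first by right; exact: leIl.
by have [mm|mm] := hM.1 _ _ Mm Mm'; [left|right]; rewrite leI2.
Qed.

Lemma antichain_chain_eq C a a' :
  chain C -> A a -> A a' -> C a -> C a' -> a = a'.
Proof.
move=> chC Aa Aa' Ca Ca'; have [h|h] := chC _ _ Ca Ca'; first exact: hA.1.
by apply/esym; exact: hA.1.
Qed.

Lemma upper_set_not_lt x a : upper_set A x -> A a -> ~~ (x < a)%O.
Proof.
move=> [a' Aa' a'x] Aa; apply/negP => xa.
have := le_lt_trans a'x xa; rewrite (hA.1 _ _ Aa' Aa) ?ltxx //.
exact: ltW (le_lt_trans a'x xa).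
Qed.

(** Extend the lower section of [x] to a maximal chain and take its element [a]
    of [A].  Either [a] is strictly above [x], which the antichain excludes, or
    [a] has the rank, hence is one, of the elements of the section. *)
Lemma upper_set_section x : upper_set A x ->
  exists a, A a /\ lower_section M x a.
Proof.
move=> Ux; have [C Cmax SC] := chain_extend (@lower_section_chain x).
have Cx : C x by apply: SC; left.
have [a [Ca Aa]] := hA.2 _ Cmax.
exists a; split=> //.
have ax : rho a <= rho x.
  rewrite leNgt; apply/negP => xa.
  have lexa := chain_rank_le hrho Cmax.1 Cx Ca (ltW xa).
  have := upper_set_not_lt Ux Aa.
  rewrite lt_neqAle lexa andbT negbK => /eqP xea.
  by rewrite xea ltxx in xa.
have [e se re] := lower_section_rank (rank_range hrho a) ax.
by rewrite -(chain_rank_inj hrho Cmax.1 (SC _ se) Ca re).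
Qed.

Definition foot x : L := xget x [set a | A a /\ lower_section M x a].

Lemma footP x : upper_set A x -> A (foot x) /\ lower_section M x (foot x).
Proof. by move=> /upper_set_section; exact: (xgetPex x). Qed.

Lemma footE x a : A a -> lower_section M x a -> foot x = a.
Proof.
move=> Aa sa; have Ux : upper_set A x by exists a; last exact: lower_section_le.
have [Af sf] := footP Ux.
exact: (antichain_chain_eq (@lower_section_chain x)).
Qed.

(** If [sup R] is the rank of an element of [A], that element is the top of the
    lattice, [A] is a singleton, and the quotient is [0 / 0 = 0] there. *)
Definition height x : K := (rho x - rho (foot x)) / (sup R - rho (foot x)).

Lemma height0 a : A a -> height a = 0.
Proof. by move=> Aa; rewrite /height (footE Aa) ?subrr ?mul0r //; left. Qed.

(** The case to consider is that of [x] and [y] outside [A].  Write the feet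
    as the meets of [x] with [m] and of [y] with [m'].  If [m <= m'], the feet
    are comparable, hence equal.  If [m' <= m], the gap of [y] only decreases
    when [m'] is replaced by [m], and [rank_modular_meet] compares the gaps
    below a common [m]. *)
Lemma foot_gap_mono x y : upper_set A x -> upper_set A y -> (x < y)%O ->
  rho x - rho (foot x) <= rho y - rho (foot y).
Proof.
move=> Ux Uy xy; have [Ay sy] := footP Uy; have [Ax sx] := footP Ux.
have le_y := rank_le hrho (lower_section_le sy).
case: sx => [->|[m Mm fx]]; first by lra.
case: sy => [fy|[m' Mm' fy]].
  by have := upper_set_not_lt Ux Ay; rewrite fy xy.
have [mm|mm] := hM.1 _ _ Mm Mm'.
  have -> : foot y = foot x.
    by apply/esym/hA.1 => //; rewrite fx fy leI2 // ltW.
  by have := rank_le hrho (ltW xy); lra.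
have := rank_modular_meet hrho (modM Mm) (ltW xy).
have : rho (y `&` m')%O <= rho (y `&` m)%O.
  by apply: (rank_le hrho); rewrite leI2.
rewrite -fx -fy; lra.
Qed.

Lemma upper_set_lt x y : upper_set A x -> (x < y)%O -> upper_set A y.
Proof. by move=> [a Aa ax] xy; exists a => //; exact: le_trans (ltW xy). Qed.

Lemma foot_rank_lt x y : upper_set A x -> (x < y)%O -> rho (foot y) < rho y.
Proof.
move=> Ux xy.
have Uy := upper_set_lt Ux xy.
have [Ay sy] := footP Uy.
apply: (rank_lt hrho); rewrite lt_neqAle (lower_section_le sy) andbT.
by apply/eqP => e; have := upper_set_not_lt Ux Ay; rewrite e xy.
Qed.

Lemma height_lt x y : upper_set A x -> (x < y)%O -> height x < height y.
Proof.
move=> Ux xy.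
have Uy := upper_set_lt Ux xy.
have gap := foot_gap_mono Ux Uy xy.
have ly := foot_rank_lt Ux xy.
have lxy := rank_lt hrho xy.
have yb := rank_le_sup y.
have lx := rank_le hrho (lower_section_le (footP Ux).2).
rewrite /height ltr_pdivrMr; last by lra.
rewrite mulrAC ltr_pdivlMr; last by lra.
nra.
Qed.

(** The set [E] in the proof is the chain of elements [e] of all ranks [u] in
    [R] described at the top.  Let [u < u'] give the meets [c `&` m] and
    [c' `&` m'].  If [m <= m'] they are ordered, as [c <= c'].  If [m' <= m],
    modularity bounds [u' - u] by [rho c' - rho c = (1 - v) (u' - u)], which is
    impossible as [v > 0]. *)
Lemma height_surj x C : upper_set A x -> maximal_chain C ->
  exists c, [/\ C c, upper_set A c & height c = height x].
Proof.
move=> Ux Cmax.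
have [Ax|nAx] := pselect (A x).
  have [c [Cc Ac]] := hA.2 _ Cmax.
  by exists c; split=> //; [exists c|rewrite !height0].
have [Af sf] := footP Ux.
have ltf : rho (foot x) < rho x.
  apply: (rank_lt hrho); rewrite lt_neqAle (lower_section_le sf) andbT.
  by apply/eqP => e; apply: nAx; rewrite -e.
have xb := rank_le_sup x.
set b := sup R in xb *; pose v := height x.
have v0 : 0 < v by rewrite /v /height -/b divr_gt0; lra.
have v1 : v <= 1 by rewrite /v /height -/b ler_pdivrMr; lra.
pose E := [set e | exists2 c, C c /\ rho c = rho e + v * (b - rho e)
                            & lower_section M c e].
have chE : chain E.
  move=> e e' Ee Ee'.
  wlog ree : e e' Ee Ee' / rho e <= rho e'.
    move=> H; have [h|h] := leP (rho e) (rho e'); first exact: H.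
    by have /or_comm := H _ _ Ee' Ee (ltW h).
  left; case: Ee Ee' => c [Cc rc] se [c' [Cc' rc'] se'].
  have eb := rank_le_sup e; have eb' := rank_le_sup e'; rewrite -/b in eb eb'.
  have cc : (c <= c')%O.
    by apply: (chain_rank_le hrho Cmax.1) => //; rewrite rc rc'; nra.
  have ec := lower_section_le se; have ec' := lower_section_le se'.
  (* e = c forces rho e = b because v > 0; then rho e' = b as well, so that
     e' = c' *)
  have top : rho e' = b -> e' = c'.
    move=> e'b; apply: (rank_le_anti hrho) => //.
    by rewrite e'b; exact: rank_le_sup.
  case: se => [ee|[m Mm ee]].
    by rewrite top ?ee //; move: rc; rewrite -ee; nra.
  case: se' => [->|[m' Mm' ee']]; first exact: le_trans cc.
  have [mm|mm] := hM.1 _ _ Mm Mm'; first by rewrite ee ee' leI2.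
  have lip := rank_modular_meet hrho (modM Mm) cc.
  have lem : rho (c' `&` m')%O <= rho (c' `&` m)%O.
    by apply: (rank_le hrho); rewrite leI2.
  rewrite -ee in lip; rewrite -ee' in lem.
  (* lip and lem give rho e' - rho e <= (1 - v) * (rho e' - rho e) *)
  have ree' : rho e' <= rho e by nra.
  have eqc : c = c'.
    apply: (chain_rank_inj hrho Cmax.1) => //; rewrite rc rc'.
    by congr (_ + _ * (_ - _)); lra.
  have e'e : (e' <= e)%O by rewrite ee ee' eqc leI2.
  by rewrite (rank_le_anti hrho e'e ree).
have surE u : R u -> exists2 e, E e & rho e = u.
  move=> Ru; have ub : u <= b by apply: ub_le_sup.
  pose r := u + v * (b - u).
  have ur : u <= r by rewrite /r; nra.
  have Rr : R r.
    (* r lies in [u, b]; if it equals b while u < b, then v = 1 and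
       rho x = b = r, which contradicts xr *)
    have [rx|xr] := leP r (rho x).
      by apply: (hRint Ru (rank_range hrho x)); rewrite ur.
    have [rb|br] := ltP r b.
      have [|w Rw rw] := sup_gt _ rb; first by exists u.
      by apply: (hRint Ru Rw); rewrite ur ltW.
    have [<-//|ub'] : u = r \/ u < b.
      move: ub; rewrite le_eqVlt => /predU1P[eub|]; last by right.
      by left; rewrite /r eub; lra.
    have v_eq1 : v = 1 by rewrite /r in br; nra.
    have : rho x - rho (foot x) = b - rho (foot x) by exact: divr1_eq v_eq1.
    by move: xr; rewrite /r v_eq1; lra.
  have [c Cc rc] := maximal_chain_rank hrho Cmax Rr.
  have [|e se re] := @lower_section_rank c u Ru; first by rewrite rc.
  by exists e => //; exists c => //; rewrite re.
have [e [[c [Cc rc] se] Ae]] := hA.2 _ (rank_maximal_chain hrho chE surE).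
exists c; split=> //; first by exists e => //; exact: lower_section_le.
rewrite /height (footE Ae se) rc -/b.
(* an element of A of rank b would be the top of L, hence above x *)
have neb : b - rho e != 0.
  apply/eqP => eb.
  have ex : (x <= e)%O.
    have -> : e = (x `|` e)%O; last exact: leUl.
    apply: (rank_le_anti hrho); first exact: leUr.
    by have := rank_le_sup (x `|` e)%O; rewrite -/b; lra.
  have := upper_set_not_lt Ux Ae; rewrite lt_neqAle ex andbT negbK => /eqP xe.
  by apply: nAx; rewrite xe.
by rewrite addrAC subrr add0r mulfK.
Qed.
End UpperHalf.

(** * Duality *)

Section Dual.
Context (K : realType) (d : Order.disp_t) (L : latticeType d).

Lemma chain_dual (C : set L) : chain (C : set L^d) <-> chain C.
Proof.
by split=> h x y Cx Cy; have [] := h x y Cx Cy; [right|left|right|left].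
Qed.

Lemma maximal_chain_dual (C : set L) :
  maximal_chain (C : set L^d) <-> maximal_chain C.
Proof.
split=> -[/chain_dual chC Cmax]; split=> // D /chain_dual; exact: Cmax.
Qed.

Lemma antichain_cutset_dual (A : set L) :
  antichain_cutset A -> antichain_cutset (A : set L^d).
Proof.
move=> [anti cut]; split; last by move=> C /maximal_chain_dual /cut.
by move=> x y Ax Ay yx; apply/esym; exact: anti.
Qed.

Lemma R_grading_dual (R : set K) (rho : L -> K) : R_grading R rho ->
  R_grading [set r | R (- r)] ((fun x => - rho x) : L^d -> K).
Proof.
move=> [Rrho hC]; split; first by move=> x _ /=; rewrite opprK; exact: Rrho.
move=> C /maximal_chain_dual /hC[[_ inj sur] mono].
split; [split|].
- by move=> x _ /=; rewrite opprK; exact: Rrho.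
- by move=> x y Cx Cy /oppr_inj; exact: inj.
- by move=> r /= /sur[c Cc rc]; exists c => //; rewrite rc opprK.
- by move=> x y Cx Cy; rewrite lerN2 mono.
Qed.

Lemma rank_modular_dual (rho : L -> K) (m : L) : rank_modular rho m ->
  rank_modular ((fun x => - rho x) : L^d -> K) m.
Proof. by move=> mm x; rewrite joinEdual meetEdual; have := mm x; lra. Qed.
End Dual.

(** * Gluing the two halves *)

(** The last property says that all maximal chains have the same image above
    [A], namely the set of all values of [s] there; the range of the glued
    function is therefore the common image of all maximal chains. *)
Lemma upper_half_rank (K : realType) (R : set K)
    (hRint : is_interval R) (hRub : has_ubound R)
    (d : Order.disp_t) (L : latticeType d) (rho : L -> K)
    (hrho : R_grading R rho) (hL : rank_supersolvable rho)
    (A : set L) (hA : antichain_cutset A) :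
  exists s : L -> K, [/\ forall a, A a -> s a = 0,
    forall x y, upper_set A x -> (x < y)%O -> s x < s y &
    forall x C, upper_set A x -> maximal_chain C ->
      exists c, [/\ C c, upper_set A c & s c = s x]].
Proof.
have [M hM modM] := hL; exists (height R rho M A); split.
- by move=> a; exact: (height0 hRint hRub hrho hM modM hA).
- by move=> x y; exact: (height_lt hRint hRub hrho hM modM hA).
- by move=> x C; exact: (height_surj hRint hRub hrho hM modM hA).
Qed.

Theorem theorem1p2 (K : realType) (R : set K)
    (hRint : is_interval R) (hRlb : has_lbound R) (hRub : has_ubound R)
    (d : Order.disp_t) (L : latticeType d) (rho : L -> K)
    (hrho : R_grading R rho) (hL : rank_supersolvable rho)
    (A : set L) (hA : antichain_cutset A) :
  exists sigma : L -> \bar K, grading sigma /\ level_set sigma A.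
Proof.
have [s [s0 s_lt s_surj]] := upper_half_rank hRint hRub hrho hL hA.
have hRint' : is_interval [set r | R (- r)].
  move=> x y Rx Ry z /andP[xz zy]; apply: (hRint _ _ Ry Rx).
  by rewrite !lerN2 zy xz.
have hRub' : has_ubound [set r | R (- r)].
  by have [l lR] := hRlb; exists (- l) => r /= /lR; rewrite lerNr.
have hL' : rank_supersolvable ((fun x => - rho x) : L^d -> K).
  have [M hM modM] := hL; exists M; first exact/maximal_chain_dual.
  by move=> m /modM; exact: rank_modular_dual.
have [t [t0 t_lt t_surj]] := upper_half_rank hRint' hRub' (R_grading_dual hrho)
  hL' (antichain_cutset_dual hA).
(* the order of L^d is reversed, so t is strictly decreasing on L below A *)
pose U := upper_set A.
pose D x := exists2 a, A a & (x <= a)%O.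
have UVD x : U x \/ D x.
  have [|C Cmax xC] := @chain_extend _ _ [set x].
    by move=> y z -> ->; left.
  have [a [Ca Aa]] := hA.2 _ Cmax.
  by have [ax|xa] := Cmax.1 _ _ Ca (xC x erefl); [left|right]; exists a.
have UD x : U x -> D x -> A x.
  move=> [a Aa ax] [a' Aa' xa'].
  have e := hA.1 _ _ Aa Aa' (le_trans ax xa').
  by have -> : x = a by apply/eqP; rewrite eq_le ax e xa'.
have AU x : A x -> U x by exists x.
have AD x : A x -> D x by exists x.
pose f x := if `[< U x >] then s x else - t x.
have fU x : U x -> f x = s x by move=> Ux; rewrite /f asboolT.
have fD x : D x -> f x = - t x.
  move=> Dx; rewrite /f; case: asboolP => // Ux.
  by rewrite s0 ?t0 ?oppr0 //; exact: UD.
have tge0 x : D x -> 0 <= t x.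
  move=> [a Aa]; rewrite le_eqVlt => /predU1P[->|ax]; first by rewrite t0.
  by rewrite -(t0 _ Aa) ltW // t_lt //; exact: AD.
have f_lt x y : (x < y)%O -> f x < f y.
  move=> xy; have [Ux|Dx] := UVD x.
    have Uy : U y := upper_set_lt Ux xy.
    by rewrite !fU // s_lt.
  have [Uy|Dy] := UVD y; last by rewrite !fD // ltrN2 t_lt.
  have [Dy|nDy] := pselect (D y); first by rewrite !fD // ltrN2 t_lt.
  rewrite fD // fU //; have [a Aa ay] := Uy.
  have : s a < s y.
    apply: s_lt; first exact: AU.
    rewrite lt_neqAle ay andbT; apply/eqP => e.
    by apply: nDy; rewrite -e; exact: AD.
  by rewrite s0 //; have := tge0 _ Dx; lra.
have f_surj x C : maximal_chain C -> exists2 c, C c & f c = f x.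
  move=> Cmax; have [Ux|Dx] := UVD x.
    by have [c [Cc Uc e]] := s_surj _ _ Ux Cmax; exists c; rewrite ?fU.
  have [c [Cc Dc e]] := t_surj _ _ Dx ((maximal_chain_dual C).2 Cmax).
  by exists c; rewrite ?fD ?e.
have fA x : f x = 0 <-> A x.
  split=> [fx0|Ax]; last by rewrite fU ?s0 //; exact: AU.
  have [C Cmax xC] := chain_extend (chain_pair (lexx x)).
  have [a [Ca Aa]] := hA.2 _ Cmax.
  have fa0 : f a = 0 by rewrite fU ?s0 //; exact: AU.
  have [ax|xa] := Cmax.1 _ _ Ca (xC x (or_introl erefl)).
    move: ax; rewrite le_eqVlt => /predU1P[<-//|/f_lt].
    by rewrite fa0 fx0 ltxx.
  move: xa; rewrite le_eqVlt => /predU1P[->//|/f_lt].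
  by rewrite fa0 fx0 ltxx.
have f_le C : chain C -> {in C &, {mono f : x y / (x <= y)%O >-> x <= y}}.
  move=> chC x y; rewrite !in_setE => Cx Cy.
  have [xy|yx] := chC _ _ Cx Cy.
    rewrite xy; move: xy.
    by rewrite le_eqVlt => /predU1P[->|/f_lt/ltW->//]; rewrite lexx.
  move: yx; rewrite le_eqVlt => /predU1P[->|yx]; first by rewrite !lexx.
  by rewrite (lt_geF yx) (lt_geF (f_lt _ _ yx)).
exists (fun x => (f x)%:E); split.
  exists (range (fun x => (f x)%:E)); split; first by move=> x _; exists x.
  move=> C Cmax; have mono := f_le _ Cmax.1; split; [split|].
  - by move=> x _; exists x.
  - by move=> x y Cx Cy [e]; apply/eqP; rewrite eq_le -!mono ?e ?lexx.
  - move=> _ [x _ <-]; have [c Cc e] := f_surj x _ Cmax.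
    by exists c; rewrite ?e.
  - by move=> x y Cx Cy; rewrite lee_fin mono.
have [C Cmax _] := @chain_extend _ L set0 (fun _ _ h => match h with end).
have [a [_ Aa]] := hA.2 _ Cmax.
exists 0%E; first by exists a => //; rewrite (fA a).2.
by apply/seteqP; split=> x /=; [move=> /fA ->|move=> [/fA]].
Qed.
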